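(* (Strong maximum principle) Let $\Omega$ be a domain (connected open set) of $\mathbb R^n$. Let $u$ be a non-negative continuous viscosity supersolution of the equation $\mathcal M_{\mathbf a}(D^2u)=0$ in $\Omega$, with $\mathcal M_{\mathbf a}\in\mathcal A_n$. If $u$ has a minimum $m$ at some point $x_0\in\Omega$, then $u\equiv m$ in $\Omega$. Similarly, let $u$ be a continuous viscosity subsolution of the equation $\mathcal M_{\mathbf a}(D^2u)=0$ in $\Omega$, with $\mathcal M_{\mathbf a}\in\mathcal A_1$. If $u$ has a maximum $M$ at $x_0\in\Omega$, then $u\equiv M$ in $\Omega$.
   Context: For a real symmetric $n\times n$ matrix $X\in\mathcal S^n$, let $\lambda_1(X)\le\dots\le\lambda_n(X)$ be its eigenvalues. For $\mathbf a=(a_1,\dots,a_n)$ with $a_i\ge0$ for all $i$ and at least one $a_j>0$, set $\mathcal M_{\mathbf a}(X)=\sum_{i=1}^n a_i\lambda_i(X)$. $\mathcal A_j$ is the class of such operators with $a_j>0$. Viscosity notions: for an open set $\Omega$, an upper semicontinuous $u$ is a viscosity subsolution of $\mathcal M_{\mathbf a}(D^2u)=f$ (also written $\mathcal M_{\mathbf a}(D^2u)\ge f$) in $\Omega$ if $\mathcal M_{\mathbf a}(X)\ge f(x)$ for all $x\in\Omega$ and all $(\xi,X)\in\mathbb R^n\times\mathcal S^n$ such that $u(y)\le u(x)+\langle\xi,y-x\rangle+\frac12\langle X(y-x),y-x\rangle+o(|y-x|^2)$ as $y\to x$. A lower semicontinuous $u$ is a viscosity supersolution (written $\mathcal M_{\mathbf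 a}(D^2u)\le f$) if $\mathcal M_{\mathbf a}(X)\le f(x)$ for all $x\in\Omega$ and all $(\xi,X)$ such that $u(y)\ge u(x)+\langle\xi,y-x\rangle+\frac12\langle X(y-x),y-x\rangle+o(|y-x|^2)$ as $y\to x$. *)

(* Defs.v *)
From HB Require Import structures.
From mathcomp Require Import all_boot all_order all_algebra.
From mathcomp Require Import all_classical all_reals all_analysis.
From mathcomp Require Import complex.
Set Implicit Arguments.
Unset Strict Implicit.
Unset Printing Implicit Defensive.
Import Order.TTheory GRing.Theory Num.Theory.
Import numFieldNormedType.Exports.
Local Open Scope classical_set_scope.
Local Open Scope ring_scope.

Section Eigenvalues.
Context {R : realType} {n : nat}.
Implicit Types (X : 'M[R]_n) (l : 'rV[R]_n).

Definition is_eigvals X l :=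
  (forall i j : 'I_n, (i <= j)%N -> l 0 i <= l 0 j) /\
  char_poly X = \prod_i ('X - (l 0 i)%:P).

(* The default value 0 is never used for symmetric X, see eigvalsP. *)
Definition eigvals X : 'rV[R]_n := xget 0 [set l | is_eigvals X l].

Lemma char_poly_similar (F : fieldType) (P A : 'M[F]_n) : P \in unitmx ->
  char_poly (invmx P *m A *m P) = char_poly A.
Proof.
move=> Pu; rewrite /char_poly.
have -> : char_poly_mx (invmx P *m A *m P) =
    map_mx polyC (invmx P) *m char_poly_mx A *m map_mx polyC P.
  rewrite /char_poly_mx mulmxBr mulmxBl -!map_mxM; congr (_ - _).
  by rewrite scalar_mxC -mulmxA -map_mxM mulVmx // map_mx1 mulmx1.
rewrite !det_mulmx mulrAC -det_mulmx -map_mxM mulVmx //.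
by rewrite map_mx1 det1 mul1r.
Qed.

Lemma eigvalsP X : X^T = X -> is_eigvals X (eigvals X).
Proof.
move=> symX; pose C := complex R.
pose A := map_mx (real_complex R) X : 'M[C]_n.
have Ah : A \is hermsymmx.
  apply: realsym_hermsym; first by
    apply/is_hermitianmxP; rewrite /= expr0 scale1r map_mx_id // map_trmx symX.
  by apply/mxOverP => i j; rewrite mxE; apply/complex_realP; exists (X i j).
have /orthomx_spectralP eA := hermitian_normalmx Ah.
have spR := hermitian_spectral_diag_real Ah.
pose d i := complex.Re (spectral_diag A 0 i).
have dE i : real_complex R (d i) = spectral_diag A 0 i.
  by rewrite RRe_real //; move/mxOverP: spR; apply.
have charX : char_poly X = \prod_i ('X - (d i)%:P).
  apply: (@map_poly_inj _ _ (real_complex R)).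
  rewrite map_char_poly -/A eA char_poly_similar ?spectral_unit //.
  rewrite char_poly_trig ?diag_mx_is_trig // rmorph_prod; apply: eq_bigr => i _.
  by rewrite rmorphB /= map_polyX map_polyC /= dE mxE eqxx mulr1n.
pose s := sort <=%R [seq d i | i <- enum 'I_n].
have ss : size s = n by rewrite size_sort size_map size_enum_ord.
have ex : is_eigvals X (\row_i s`_i).
  split=> [i j ij|].
    rewrite !mxE; apply: (sorted_leq_nth le_trans le_refl) => //.
    - exact: (sort_sorted (@le_total _ _)).
    - by rewrite inE ss.
    - by rewrite inE ss.
  rewrite charX; under [RHS]eq_bigr do rewrite mxE.
  rewrite -(big_mkord xpredT (fun i => 'X - (s`_i)%:P)) -[X in index_iota _ X]ss.
  rewrite -(big_nth 0 xpredT (fun c => 'X - c%:P)).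
  rewrite (perm_big [seq d i | i <- enum 'I_n]) /=; last by rewrite perm_sort.
  by rewrite big_map big_enum.
by rewrite /eigvals; case: xgetP => [l _ //|/(_ _ ex)].
Qed.

End Eigenvalues.

Section Operators.
Context {R : realType} {n : nat}.

Definition Mop (a : 'I_n -> R) (X : 'M[R]_n) : R :=
  \sum_i a i * eigvals X 0 i.

(* Mop a belongs to the class A_j. *)
Definition classA (j : 'I_n) (a : 'I_n -> R) :=
  [/\ forall i, 0 <= a i, exists i, 0 < a i & 0 < a j].

End Operators.

Section Viscosity.
Context {R : realType} {n : nat}.
Implicit Types (Omega : set 'rV[R]_n) (u f : 'rV[R]_n -> R) (a : 'I_n -> R).

Definition dotv (v w : 'rV[R]_n) : R := (v *m w^T) 0 0.

(* Vectors are rows: for symmetric X, w *m X is the row form of X w. *)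
Definition quad u x xi (X : 'M[R]_n) y : R :=
  u x + dotv xi (y - x) + 2^-1 * dotv ((y - x) *m X) (y - x).

(* The Euclidean |y - x|^2 is used; the library norm on rows is the sup norm. *)
Definition superjet u (x xi : 'rV[R]_n) (X : 'M[R]_n) :=
  exists2 r : 'rV[R]_n -> R,
    r =o_x (fun y => dotv (y - x) (y - x)) &
    \forall y \near x, u y <= quad u x xi X y + r y.

Definition subjet u (x xi : 'rV[R]_n) (X : 'M[R]_n) :=
  exists2 r : 'rV[R]_n -> R,
    r =o_x (fun y => dotv (y - x) (y - x)) &
    \forall y \near x, u y >= quad u x xi X y + r y.

(* As Omega is open, the values of u outside Omega are irrelevant in the
   notions below. *)
Definition usc_in Omega u := forall x, Omega x ->
  forall c, u x < c -> \forall y \near x, u y < c.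

Definition lsc_in Omega u := forall x, Omega x ->
  forall c, c < u x -> \forall y \near x, c < u y.

Definition viscosity_subsolution Omega a f u :=
  usc_in Omega u /\
  forall x, Omega x -> forall (xi : 'rV[R]_n) (X : 'M[R]_n), X^T = X ->
    superjet u x xi X -> Mop a X >= f x.

Definition viscosity_supersolution Omega a f u :=
  lsc_in Omega u /\
  forall x, Omega x -> forall (xi : 'rV[R]_n) (X : 'M[R]_n), X^T = X ->
    subjet u x xi X -> Mop a X <= f x.

End Viscosity.

(* Main.v *)
Require Import Defs.
From mathcomp Require Import all_boot all_order all_algebra.
From mathcomp Require Import all_classical all_reals all_analysis.
From mathcomp Require Import ring lra.
Import Order.TTheory GRing.Theory Num.Theory.
Import numFieldNormedType.Exports.
Local Open Scope classical_set_scope.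
Local Open Scope ring_scope.

(** The set where [u] attains its minimum [m] is closed in the connected set
    [Omega], so it suffices to show that it is open. If it is not, there is an
    open ball, centred at some [p], in whose trace on [Omega] one has [m < u],
    and whose boundary passes through a point [z] of the minimum set
    ([interior_touching_ball]).

    With [e = p - z] and [w = y - z], consider the quadratic
    [q y = e.w + a (e.w)^2 / 2 - |w|^2]. Close to [z] its superlevel set
    [0 <= q] is contained in the ball together with [z], because the ball is
    [|w|^2 < 2 e.w]. For small [eps] this forces [u - eps q] to have a local
    minimum near [z], whence a subjet of [u] whose matrix is
    [eps (a e^T e - 2 I)] ([touching_ball_subjet]). It is
    the term [- |w|^2] that bends the level set of [q] inside the ball, whatever
    [a] is, so that [a] remains free.

    That matrix has the eigenvalue [eps (a |e|^2 - 2)] and otherwise only the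
    eigenvalue [- 2 eps]. As the weight of the largest eigenvalue is positive,
    the operator is positive on it once [a] is large
    ([Mop_rank1_shift_ge]), which contradicts the supersolution property.

    For a subsolution with a maximum the same argument is applied to [- u],
    whose subjets are the opposites of the superjets of [u]; the opposite matrix
    has one very negative eigenvalue, weighted by the coefficient of the
    smallest eigenvalue ([Mop_rank1_shift_le]). *)

(** * Euclidean inner product and rank-one perturbations of scalar matrices *)

Section Dot.
Context {R : realType} {n : nat}.
Implicit Types (v w e : 'rV[R]_n) (a b c : R).

Lemma dotvE v w : dotv v w = \sum_i v 0 i * w 0 i.
Proof. by rewrite /dotv mxE; apply: eq_bigr => i _; rewrite mxE. Qed.

Lemma dotvC v w : dotv v w = dotv w v.
Proof. by rewrite !dotvE; apply: eq_bigr => i _; rewrite mulrC. Qed.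

Lemma dotvDl v1 v2 w : dotv (v1 + v2) w = dotv v1 w + dotv v2 w.
Proof. by rewrite /dotv mulmxDl mxE. Qed.

Lemma dotvZl a v w : dotv (a *: v) w = a * dotv v w.
Proof. by rewrite /dotv -scalemxAl mxE. Qed.

Lemma dotvNl v w : dotv (- v) w = - dotv v w.
Proof. by rewrite -scaleN1r dotvZl mulN1r. Qed.

Lemma dotvBl v1 v2 w : dotv (v1 - v2) w = dotv v1 w - dotv v2 w.
Proof. by rewrite dotvDl dotvNl. Qed.

Lemma dotvDr v w1 w2 : dotv v (w1 + w2) = dotv v w1 + dotv v w2.
Proof. by rewrite !(dotvC v) dotvDl. Qed.

Lemma dotvBr v w1 w2 : dotv v (w1 - w2) = dotv v w1 - dotv v w2.
Proof. by rewrite !(dotvC v) dotvBl. Qed.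

Lemma dotvv_ge0 v : 0 <= dotv v v.
Proof. by rewrite dotvE; apply: sumr_ge0 => i _; exact: sqr_ge0. Qed.

Lemma sqr_coord_le_dotv v i : v 0 i ^+ 2 <= dotv v v.
Proof.
rewrite dotvE (bigD1 i) //= expr2 lerDl.
by apply: sumr_ge0 => j _; exact: sqr_ge0.
Qed.

Lemma dotvv_eq0 v : dotv v v = 0 -> v = 0.
Proof.
move=> v0; apply/rowP => i; rewrite mxE; apply/eqP.
by rewrite -sqrf_eq0 eq_le sqr_ge0 -v0 sqr_coord_le_dotv.
Qed.

Lemma dotvv_gt0 v : v != 0 -> 0 < dotv v v.
Proof.
by rewrite lt_neqAle dotvv_ge0 andbT; apply: contra_neq => /esym /dotvv_eq0.
Qed.

Definition sqdist v w : R := dotv (v - w) (v - w).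

Lemma sqdistxx v : sqdist v v = 0.
Proof. by rewrite /sqdist subrr /dotv mul0mx mxE. Qed.

Lemma sqdistC v w : sqdist v w = sqdist w v.
Proof. by rewrite /sqdist -opprB dotvNl dotvC dotvNl opprK. Qed.

Lemma dotv_continuous (f g : 'rV[R]_n -> 'rV[R]_n) :
  continuous f -> continuous g -> continuous (fun x => dotv (f x) (g x)).
Proof.
move=> cf cg; under eq_fun do rewrite dotvE.
apply: continuous_big => [|i _ x]; first exact: add_continuous.
pose c (v : 'rV[R]_n) := v 0 i.
apply: (@continuousM _ _ (c \o f) (c \o g)).
- by apply: continuous_comp; [exact: cf|exact: coord_continuous].
- by apply: continuous_comp; [exact: cg|exact: coord_continuous].
Qed.

Lemma continuous_subr w : continuous (fun v => v - w).
Proof.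
by move=> v; apply: continuousB; [exact: cvg_id|exact: cst_continuous].
Qed.

Lemma sqdist_continuous w : continuous (sqdist ^~ w).
Proof. by apply: dotv_continuous; exact: continuous_subr. Qed.

(** The shape of every test Hessian: it multiplies [e] by
    [b + a * dotv e e] and each row orthogonal to [e] by [b]. *)
Definition rank1_shift e a b : 'M[R]_n := a *: (e^T *m e) + b%:M.

Lemma rank1_shiftZ c e a b :
  c *: rank1_shift e a b = rank1_shift e (c * a) (c * b).
Proof. by rewrite /rank1_shift scalerDr scalerA scale_scalar_mx. Qed.

Lemma rank1_shift_sym e a b : (rank1_shift e a b)^T = rank1_shift e a b.
Proof.
by rewrite /rank1_shift linearD linearZ /= trmx_mul trmxK tr_scalar_mx.
Qed.

Lemma mul_rank1_shift v e a b :
  v *m rank1_shift e a b = (a * dotv v e) *: e + b *: v.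
Proof.
rewrite /rank1_shift mulmxDr mul_mx_scalar -scalemxAr mulmxA.
by rewrite [v *m e^T]mx11_scalar mul_scalar_mx scalerA.
Qed.

End Dot.

(** * Eigenvalues of the test matrices *)

Section Eig.
Context {R : realType} {n : nat}.
Implicit Types (e : 'rV[R]_n.+1) (X : 'M[R]_n.+1) (a b c : R).

Lemma eigenvalue_eigvals X c : X^T = X ->
  eigenvalue X c <-> exists i, eigvals X 0 i = c.
Proof.
move=> symX; have [_ cX] := eigvalsP symX.
rewrite eigenvalue_root_char cX.
rewrite -(big_map (fun i => eigvals X 0 i) xpredT (fun t => 'X - t%:P)).
rewrite root_prod_XsubC.
by split=> [/mapP[i _ ->]|[i <-]]; [exists i|rewrite map_f ?mem_index_enum].
Qed.

Lemma eigvals_le_max X i : X^T = X -> eigvals X 0 i <= eigvals X 0 ord_max.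
Proof. by move=> /eigvalsP[le _]; apply: le; exact: leq_ord. Qed.

Lemma eigvals_ge_min X i : X^T = X -> eigvals X 0 ord0 <= eigvals X 0 i.
Proof. by move=> /eigvalsP[le _]; apply: le. Qed.

(** A row eigenvector [v] for [c] satisfies
    [(c - b) *: v = (a * dotv v e) *: e]; pairing this with [e] leaves only two
    possible values of [c]. *)
Lemma eigvals_rank1_shift e a b i :
  eigvals (rank1_shift e a b) 0 i \in [:: b; b + a * dotv e e].
Proof.
set X := rank1_shift e a b; set c := eigvals X 0 i.
have : eigenvalue X c.
  by apply/eigenvalue_eigvals; [exact: rank1_shift_sym|exists i].
move=> /eigenvalueP[v]; rewrite mul_rank1_shift => ve v0.
rewrite !inE; have [//|cb /=] := eqVneq c b.
have vE : (c - b) *: v = (a * dotv v e) *: e by rewrite scalerBl -ve addrK.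
have /eqP : (c - b) * dotv v e = a * dotv v e * dotv e e.
  by rewrite -dotvZl vE dotvZl.
have [d0|d0] := eqVneq (dotv v e) 0.
  move: vE; rewrite d0 mulr0 scale0r => /eqP.
  by rewrite scaler_eq0 subr_eq0 (negPf cb) (negPf v0).
rewrite [a * _]mulrC -mulrA [X in X == _]mulrC (inj_eq (mulfI d0)).
by rewrite subr_eq addrC.
Qed.

Lemma rank1_shift_eigval e a b : e != 0 ->
  exists i, eigvals (rank1_shift e a b) 0 i = b + a * dotv e e.
Proof.
move=> e0; apply/eigenvalue_eigvals; first exact: rank1_shift_sym.
apply/eigenvalueP; exists e => //.
by rewrite mul_rank1_shift -scalerDl addrC.
Qed.

(** For [0 <= a] every eigenvalue is at least [b], and the exceptional value
    [b + a * dotv e e], being an eigenvalue, is at most the last one. Only the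
    weight of the largest eigenvalue sees the size of [a]: this is where
    membership in the class of [ord_max] enters. *)
Lemma Mop_rank1_shift_ge (k : 'I_n.+1 -> R) e a b :
  (forall i, 0 <= k i) -> e != 0 -> 0 <= a ->
  (\sum_i k i) * b + k ord_max * (a * dotv e e) <= Mop k (rank1_shift e a b).
Proof.
move=> k0 e0 a0; set X := rank1_shift e a b.
have aee : 0 <= a * dotv e e by rewrite mulr_ge0 // dotvv_ge0.
have ge i : b <= eigvals X 0 i.
  by move: (eigvals_rank1_shift e a b i); rewrite !inE => /orP[] /eqP ->; lra.
have gem : b + a * dotv e e <= eigvals X 0 ord_max.
  have [i <-] := rank1_shift_eigval e a b e0.
  by apply: eigvals_le_max; exact: rank1_shift_sym.
rewrite /Mop mulr_suml (bigD1 ord_max) //= [leRHS](bigD1 ord_max) //=.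
rewrite addrAC -mulrDr; apply: lerD; first exact: ler_wpM2l.
by apply: ler_sum => i _; exact: ler_wpM2l.
Qed.

(** The mirror estimate, where the exceptional value bounds the smallest
    eigenvalue from above and the weight of [ord0] comes into play. *)
Lemma Mop_rank1_shift_le (k : 'I_n.+1 -> R) e a b :
  (forall i, 0 <= k i) -> e != 0 -> a <= 0 ->
  Mop k (rank1_shift e a b) <= (\sum_i k i) * b + k ord0 * (a * dotv e e).
Proof.
move=> k0 e0 a0; set X := rank1_shift e a b.
have aee : a * dotv e e <= 0 by rewrite mulr_le0_ge0 // dotvv_ge0.
have le i : eigvals X 0 i <= b.
  by move: (eigvals_rank1_shift e a b i); rewrite !inE => /orP[] /eqP ->; lra.
have lem : eigvals X 0 ord0 <= b + a * dotv e e.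
  have [i <-] := rank1_shift_eigval e a b e0.
  by apply: eigvals_ge_min; exact: rank1_shift_sym.
rewrite /Mop mulr_suml (bigD1 ord0) //= [in leRHS](bigD1 ord0) //=.
rewrite [in leRHS]addrAC -mulrDr; apply: lerD; first exact: ler_wpM2l.
by apply: ler_sum => i _; exact: ler_wpM2l.
Qed.

End Eig.

(** * Jets and quadratic test functions *)

Section Jets.
Context {R : realType} {n : nat}.
Implicit Types (u : 'rV[R]_n -> R) (v w x y z e : 'rV[R]_n) (X : 'M[R]_n).

Lemma dotv_mulmxA v X w : dotv (v *m X) w = dotv v (w *m X^T).
Proof. by rewrite /dotv trmx_mul trmxK mulmxA. Qed.

(** A quadratic function is its own second order expansion at every point, so
    the remainder of the jet can be taken to be zero. *)
Lemma subjet_quadratic u x z e X (c : R) : X^T = X ->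
  let phi y := c * (dotv e (y - z) + 2^-1 * dotv ((y - z) *m X) (y - z)) in
  (\forall y \near x, u x - phi x <= u y - phi y) ->
  subjet u x (c *: (e + (x - z) *m X)) (c *: X).
Proof.
move=> sX phi mn; exists (fun=> 0).
  by apply/eqoP => eps e0; near=> y; rewrite normr0 mulr_ge0 // ltW.
apply: filterS mn => y; rewrite addr0 /quad /phi.
have -> : y - z = (y - x) + (x - z) by rewrite addrA subrK.
move: (y - x) (x - z) => v w.
rewrite -scalemxAr !mulmxDl !dotvZl !dotvDl !dotvDr.
rewrite [dotv (v *m X) w]dotv_mulmxA sX [dotv v _]dotvC.
by lra.
Unshelve. all: by end_near. Qed.

Lemma superjetN u x xi X :
  subjet (\- u) x xi X -> superjet u x (- xi) (- X).
Proof.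
move=> [r ro le]; exists (\- r).
  apply/eqoP => eps e0; move/eqoP : ro => /(_ eps e0).
  by apply: filterS => y; rewrite normrN.
apply: filterS le => y; rewrite /quad /= mulmxN !dotvNl; lra.
Qed.

Lemma closed_ball_compact z (d : R) : 0 < d -> compact (closed_ball z d).
Proof.
move=> d0; apply: bounded_closed_compact; last exact: closed_ball_closed.
exists (`|z| + d); split=> [|M ltM y]; first exact: num_real.
rewrite closed_ballE // /closed_ball_ /= => zy; apply: le_trans (ltW ltM).
rewrite -[y](subrK z) addrC (le_trans (ler_normD _ _)) // lerD2l.
by rewrite distrC.
Qed.

Lemma mx_norm_le v (d : R) : 0 <= d ->
  (forall i, `|v 0 i| <= d) -> `|v| <= d.
Proof.
move=> d0 le; rewrite [leLHS]mx_normrE; apply/bigmax_leP; split=> // -[i j] _.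
by rewrite ord1 /=.
Qed.

End Jets.

(** * The strong minimum principle *)

Section StrongMinimum.
Context {R : realType} {n : nat}.
Context (Omega : set 'rV[R]_n) (u : 'rV[R]_n -> R) (m : R).
Context (Omega_open : open Omega).
Context (u_cont : forall x, Omega x -> {for x, continuous u}).
Context (u_ge : forall x, Omega x -> m <= u x).

Let above := Omega `&` [set x | m < u x].

Lemma open_above : open above.
Proof.
rewrite openE => x [Ox ux]; apply: filterI; first exact: open_nbhs_nbhs.
exact: (cvgr_gt (u x) (u_cont _ Ox) m ux).
Qed.

Lemma notin_above x : Omega x -> ~ above x -> u x = m.
Proof.
move=> Ox nx; apply/eqP; rewrite eq_le u_ge // andbT leNgt.
by apply/negP => ux; exact: nx.
Qed.

(** If [u] is not constantly [m] near [z0], choose [p] with [m < u p] very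
    close to [z0] and let [z] be a point of the minimum set closest to [p]. The
    ball around [p] through [z] then lies above the minimum, and it is too small
    to leave the neighbourhood of [z0] in which the closest point was sought. *)
Lemma interior_touching_ball z0 : Omega z0 -> u z0 = m ->
  ~ (\forall y \near z0, u y = m) ->
  exists z p, [/\ Omega z, u z = m, p != z &
    forall y, Omega y -> sqdist y p < sqdist z p -> m < u y].
Proof.
move=> Oz0 uz0 nz0.
have /nbhs_closedballP[d dK] : nbhs z0 Omega by exact: open_nbhs_nbhs.
set K := closed_ball z0 d%:num in dK.
have d2 : 0 < d%:num / 2 :> R by rewrite divr_gt0.
have near_p : \forall y \near z0, Omega y /\ sqdist y z0 < (d%:num / 2) ^+ 2.
  near=> y; split; near: y; first exact: open_nbhs_nbhs.
  apply: (cvgr_lt (sqdist z0 z0) (sqdist_continuous z0 z0) _).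
  by rewrite sqdistxx exprn_gt0.
have [p [Op pz0 up]] : exists p,
    [/\ Omega p, sqdist p z0 < (d%:num / 2) ^+ 2 & u p <> m].
  apply: contra_notP nz0 => no_p; apply: filterS near_p => y [Oy yz0].
  by apply: contrapT => uy; apply: no_p; exists y.
have above_z0 : ~ above z0 by case=> _ /=; rewrite uz0 ltxx.
have Kz0 : K z0 by apply: subset_closed_ball; exact: ballxx.
have cS : compact (K `&` ~` above).
  apply: compact_closedI; first exact: closed_ball_compact.
  by apply: open_closedC; exact: open_above.
have [||z /set_mem[Kz nz] zmin] := EVT_min_rV (f := sqdist ^~ p) _ cS.
- by exists z0.
- by apply: continuous_subspaceT; exact: sqdist_continuous.
have Oz := dK _ Kz; have uzm := notin_above _ Oz nz.
exists z, p; split => //.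
  by apply/eqP => pz; apply: up; rewrite pz.
move=> y Oy yp; apply: contrapT => ym.
suff Ky : K y.
  by move: yp; rewrite ltNge zmin //; apply/mem_set; split => // -[].
rewrite /K closed_ballE // /closed_ball_ /=; apply: mx_norm_le => // i.
have zz0 : sqdist z p <= sqdist z0 p by apply: zmin; exact/mem_set.
(* The coordinates of y and of z0 are within d / 2 of those of p, since neither
   point is farther from p than z0 is. *)
have near_i (v : 'rV[R]_n) : sqdist v p < (d%:num / 2) ^+ 2 ->
    `|v 0 i - p 0 i| < d%:num / 2.
  move=> vp; rewrite -ltr_sqr ?nnegrE ?normr_ge0 ?(ltW d2) //.
  rewrite real_normK ?num_real //.
  by apply: le_lt_trans vp; have := sqr_coord_le_dotv (v - p) i; rewrite !mxE.
have z0p : sqdist z0 p < (d%:num / 2) ^+ 2 by rewrite sqdistC.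
have yi := near_i y (lt_trans yp (le_lt_trans zz0 z0p)).
have z0i := near_i z0 z0p.
rewrite !mxE (_ : _ - _ = (z0 0 i - p 0 i) - (y 0 i - p 0 i)); last by ring.
rewrite (le_trans (ler_normB _ _)) // [leRHS]splitr.
by rewrite lerD // ltW.
Unshelve. all: by end_near. Qed.

(** Near [z] the superlevel set [0 <= q] of the quadratic [q] lies, apart from
    [z] itself, inside the open ball around [p], where [m < u]. Hence on the
    boundary of a small box around [z] the function [u - eps * q] exceeds [m],
    its value at [z], provided [eps] is small: it has an interior minimum, at
    which [u] is touched from below by [eps * q] plus a constant. *)
Lemma touching_ball_subjet z p (a : R) : Omega z -> u z = m -> p != z ->
  (forall y, Omega y -> sqdist y p < sqdist z p -> m < u y) -> 0 < a ->
  exists eps x xi, [/\ 0 < eps, Omega x &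
    subjet u x xi (rank1_shift (p - z) (eps * a) (- (eps * 2)))].
Proof.
move=> Oz uz pz in_ball a0; pose e := p - z; pose X := rank1_shift e a (- 2).
(* The term -2 in the Hessian of q makes its level set through z more curved
   than the sphere: 0 <= q reads |y - z|^2 <= t + a t^2 / 2, while the ball is
   |y - z|^2 < 2 t. *)
pose t (y : 'rV[R]_n) := dotv e (y - z).
pose q (y : 'rV[R]_n) := t y + 2^-1 * dotv ((y - z) *m X) (y - z).
have qE y : q y = t y + (a * t y) * t y / 2 - dotv (y - z) (y - z).
  rewrite /q /t /X; move: (y - z) (e) => w v.
  by rewrite mul_rank1_shift dotvDl !dotvZl [dotv w v]dotvC; field.
have ct : continuous t.
  apply: dotv_continuous => [y|].
    exact: cst_continuous.
  exact: continuous_subr.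
have cq (y : 'rV[R]_n) : {for y, continuous q}.
  rewrite (funext qE : q = _).
  exact: (cvgB (cvgD (ct y) (cvgM (cvgM (cvgM (cvg_cst a) (ct y)) (ct y))
    (cvg_cst (2^-1 : R)))) (sqdist_continuous z y)).
have tz : t z = 0 by rewrite /t dotvC subrr /dotv mul0mx mxE.
have qz : q z = 0 by rewrite qE tz [dotv _ _]sqdistxx !mulr0 mul0r addr0 subr0.
have /nbhs_closedballP[d dK] :
    \forall y \near z, [/\ Omega y, `|t y| <= 1 & `|a * t y| <= 1].
  have tz0 (c : R) : 0 < c -> \forall y \near z, `|t y| <= c.
    move=> c0; have := ct z.
    rewrite /continuous_at tz => /cvgrPdist_le /(_ c c0).
    by apply: filterS => y; rewrite sub0r normrN.
  near=> y; split; near: y; first exact: open_nbhs_nbhs.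
    exact: tz0.
  have := tz0 a^-1; rewrite invr_gt0 => /(_ a0); apply: filterS => y ty.
  by rewrite normrM gtr0_norm // mulrC -ler_pdivlMr // div1r.
(* On K the quadratic correction a t^2 / 2 is at most |t| / 2. *)
set K := closed_ball z d%:num in dK.
have zb : ball z d%:num z by exact: ballxx.
have KO y : K y -> Omega y by move=> /dK[].
have q_le y : K y -> q y <= 3 / 2.
  move=> /dK[_]; rewrite !ler_norml => /andP[t1 t2] /andP[t3 t4].
  have := dotvv_ge0 (y - z); rewrite qE; nra.
have u_gt y : K y -> y != z -> 0 <= q y -> m < u y.
  move=> Ky yz; rewrite qE; have [Oy _] := dK _ Ky.
  rewrite ler_norml => /andP[t3 t4] q0; apply: in_ball => //.
  have w0 : 0 < dotv (y - z) (y - z) by rewrite dotvv_gt0 // subr_eq0.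
  have -> : sqdist y p = dotv (y - z) (y - z) - 2 * t y + dotv e e.
    have -> : sqdist y p = dotv ((y - z) - e) ((y - z) - e).
      by rewrite /e opprB addrA subrK.
    rewrite /t; move: (y - z) (e) => w v.
    by rewrite !dotvBl !dotvBr [dotv w v]dotvC; ring.
  have -> : sqdist z p = dotv e e by rewrite sqdistC.
  have t0 : 0 < t y by nra.
  by nra.
have Kcpt : compact K by exact: closed_ball_compact.
pose B := K `&` ([set y | 0 <= q y] `&` ~` ball z d%:num).
have [eta eta0 u_eta] : exists2 eta, 0 < eta & forall y, B y -> m + eta <= u y.
  have [B0|/set0P B0] := eqVneq B set0.
    by exists 1 => // y; rewrite B0.
  have [||c /set_mem[Kc [qc bc]] cmin] := EVT_min_rV B0 _ _ (f := u).
  - apply: compact_closedI Kcpt _; apply: closedI.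
      exact: (closed_comp (fun y _ => cq y) (@closed_ge _ 0)).
    by apply: open_closedC; exact: ball_open.
  - apply: continuous_in_subspaceT => y /set_mem[/KO Oy _]; exact: u_cont.
  exists (u c - m).
    by rewrite subr_gt0 u_gt //; apply: contra_notN bc => /eqP ->.
  by move=> y /mem_set /cmin; lra.
(* eps * q <= 3 / 4 * eta on K, below the gap eta on the part of the boundary
   where q is nonnegative. *)
pose eps := eta / 2; have eps0 : 0 < eps by rewrite divr_gt0.
pose g (y : 'rV[R]_n) := u y - eps * q y.
have cg (y : 'rV[R]_n) : K y -> {for y, continuous g}.
  by move=> /KO /u_cont uy; exact: (cvgB uy (cvgM (cvg_cst eps) (cq y))).
have [||x /set_mem Kx xmin] := EVT_min_rV (f := g) _ Kcpt.
- by exists z; exact: subset_closed_ball.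
- by apply: continuous_in_subspaceT => y /set_mem /cg.
have gx : g x <= m.
  have <- : g z = m by rewrite /g qz mulr0 subr0.
  by apply: xmin; apply/mem_set; exact: subset_closed_ball.
have bx : ball z d%:num x.
  apply: contrapT => nbx; have := u_ge _ (KO _ Kx); have := q_le _ Kx.
  move: gx; rewrite /g; have [qx|qx] := leP 0 (q x).
    have : m + eta <= u x by apply: u_eta.
    rewrite /eps; nra.
  nra.
exists eps, x, (eps *: (e + (x - z) *m X)); split => //; first exact: KO.
have -> : rank1_shift (p - z) (eps * a) (- (eps * 2)) = eps *: X.
  by rewrite rank1_shiftZ mulrN.
apply: subjet_quadratic; first exact: rank1_shift_sym.
have : nbhs x (ball z d%:num).
  by apply: open_nbhs_nbhs; split => //; exact: ball_open.
apply: filterS => y yb; apply: xmin.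
by apply/mem_set; exact: subset_closed_ball.
Unshelve. all: by end_near. Qed.

(** The equation enters only through the exclusion of the jets produced by
    [touching_ball_subjet], so that the same statement serves [u] and [- u]. *)
Lemma strong_minimum_principle : connected Omega ->
  (forall e : 'rV[R]_n, e != 0 -> exists2 a : R, 0 < a &
    forall eps x xi, 0 < eps -> Omega x ->
      ~ subjet u x xi (rank1_shift e (eps * a) (- (eps * 2)))) ->
  forall x0, Omega x0 -> u x0 = m -> forall x, Omega x -> u x = m.
Proof.
move=> conn no_jet x0 Ox0 ux0.
suff SO : Omega `&` [set x | u x = m] = Omega by move=> x; rewrite -SO => -[].
apply: conn; first by exists x0.
- exists ((Omega `&` [set x | u x = m])°); first exact: open_interior.
  apply/seteqP; split=> [x [Ox ux]|x [_ /interior_subset //]]; split => //.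
  apply: filterI; first exact: open_nbhs_nbhs.
  apply: contrapT => nx.
  have [z [p [Oz uz pz in_ball]]] := interior_touching_ball _ Ox ux nx.
  have [|a a0 nj] := no_jet (p - z); first by rewrite subr_eq0.
  have [eps [y [xi [eps0 Oy]]]] :=
    touching_ball_subjet _ _ _ Oz uz pz in_ball a0.
  exact: nj.
- exists (~` above); first by apply: open_closedC; exact: open_above.
  apply/seteqP; split=> x [Ox ux]; split=> //; last exact: notin_above.
  by case=> _ /=; rewrite ux ltxx.
Qed.

End StrongMinimum.

(** * Steep test matrices and the two maximum principles *)

Section Steepness.
Context {R : realType} {n : nat}.
Implicit Types (k : 'I_n.+1 -> R) (e : 'rV[R]_n.+1).

Lemma steep_coefficient (s c d : R) : 0 <= s -> 0 < c -> 0 < d ->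
  exists2 a, 0 < a & s * 2 < c * (a * d).
Proof.
move=> s0 c0 d0; have cd : 0 < c * d by exact: mulr_gt0.
exists ((s * 2 + 1) / (c * d)); first by rewrite divr_gt0 // ltr_wpDl ?mulr_ge0.
rewrite mulrCA divfK ?gt_eqF //; lra.
Qed.

Lemma classA_max_steep k e : classA ord_max k -> e != 0 ->
  exists2 a, 0 < a & forall eps : R, 0 < eps ->
    0 < Mop k (rank1_shift e (eps * a) (- (eps * 2))).
Proof.
move=> [k0 _ kmax] e0.
have s0 : 0 <= \sum_i k i by apply: sumr_ge0.
have [a a0 big_a] := steep_coefficient _ _ _ s0 kmax (dotvv_gt0 _ e0).
exists a => // eps eps0; have ea : 0 <= eps * a by rewrite mulr_ge0 ?ltW.
apply: lt_le_trans (Mop_rank1_shift_ge k e _ _ k0 e0 ea).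
have := mulr_gt0 eps0 (_ : 0 < k ord_max * (a * dotv e e) - (\sum_i k i) * 2).
by rewrite subr_gt0 => /(_ big_a); lra.
Qed.

Lemma classA_min_steep k e : classA ord0 k -> e != 0 ->
  exists2 a, 0 < a & forall eps : R, 0 < eps ->
    Mop k (- rank1_shift e (eps * a) (- (eps * 2))) < 0.
Proof.
move=> [k0 _ kmin] e0.
have s0 : 0 <= \sum_i k i by apply: sumr_ge0.
have [a a0 big_a] := steep_coefficient _ _ _ s0 kmin (dotvv_gt0 _ e0).
exists a => // eps eps0; rewrite -scaleN1r rank1_shiftZ.
have ea : -1 * (eps * a) <= 0 by rewrite mulN1r oppr_le0 mulr_ge0 ?ltW.
apply: le_lt_trans (Mop_rank1_shift_le k e _ _ k0 e0 ea) _.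
have := mulr_gt0 eps0 (_ : 0 < k ord0 * (a * dotv e e) - (\sum_i k i) * 2).
by rewrite subr_gt0 => /(_ big_a); lra.
Qed.

End Steepness.

Theorem theorem6p2 (R : realType) (n : nat) (Omega : set 'rV[R]_n.+1)
    (Omega_open : open Omega) (Omega_connected : connected Omega) :
  (forall (a : 'I_n.+1 -> R) (u : 'rV[R]_n.+1 -> R) (m : R) (x0 : 'rV[R]_n.+1),
     classA ord_max a ->
     {within Omega, continuous u} ->
     (forall x, Omega x -> 0 <= u x) ->
     viscosity_supersolution Omega a (fun=> 0) u ->
     Omega x0 -> u x0 = m -> (forall x, Omega x -> m <= u x) ->
     forall x, Omega x -> u x = m) /\
  (forall (a : 'I_n.+1 -> R) (u : 'rV[R]_n.+1 -> R) (M : R) (x0 : 'rV[R]_n.+1),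
     classA ord0 a ->
     {within Omega, continuous u} ->
     viscosity_subsolution Omega a (fun=> 0) u ->
     Omega x0 -> u x0 = M -> (forall x, Omega x -> u x <= M) ->
     forall x, Omega x -> u x = M).
Proof.
split=> a u m x0 aA uc.
  move=> _ [_ super] Ox0 ux0 u_ge.
  rewrite continuous_open_subspace // in uc.
  apply: (strong_minimum_principle Omega u m _ _ _ Omega_connected _ x0) => //.
    by move=> x /mem_set /uc.
  move=> e e0; have [c c0 Mpos] := classA_max_steep a e aA e0; exists c => //.
  move=> eps x xi eps0 Ox /(super x Ox xi _ (rank1_shift_sym _ _ _)).
  by rewrite leNgt Mpos.
move=> [_ sub] Ox0 ux0 u_le x Ox; apply: oppr_inj.
rewrite continuous_open_subspace // in uc.
apply: (strong_minimum_principle Omega (\- u) (- m) _ _ _ Omega_connected _ x0)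
  => //.
- by move=> y /mem_set /uc uy; exact: (cvgN uy).
- by move=> y Oy; rewrite lerN2 u_le.
- move=> e e0; have [c c0 Mneg] := classA_min_steep a e aA e0; exists c => //.
  move=> eps y xi eps0 Oy /superjetN /(sub y Oy _ _ _).
  by rewrite linearN /= rank1_shift_sym => /(_ erefl); rewrite leNgt Mneg.
- by rewrite /= ux0.
Qed.
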